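(* Let $G$ be a directed graph (possibly infinite) with no loops. Then $G$ has infinite chromatic number if and only if $G$ is accessible.
   Context: A directed graph $G = (V,E)$ consists of a vertex set $V$ and an edge set $E \subseteq V \times V$ of ordered pairs; a loop is an edge of the form $(v,v)$. $G$ has infinite chromatic number if every coloring of $V$ with finitely many colors contains a pair of adjacent vertices (vertices $x,y$ with $(x,y) \in E$) of the same color. $G$ is accessible if every coloring of $V$ with finitely many colors contains arbitrarily long monochromatic directed paths, i.e. for every positive integer $n$ there are distinct vertices $v_1, \dots, v_n$, all of the same color, with $(v_i, v_{i+1}) \in E$ for all $1 \le i < n$. *)

(* Defs.v *)
From mathcomp Require Import all_boot.

Set Implicit Arguments.
Unset Strict Implicit.
Unset Printing Implicit Defensive.

(* A directed graph on the (possibly infinite) vertex type V is an arbitrary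
   relation E : V -> V -> Prop; no decidability is assumed. *)

Definition loopless (V : Type) (E : V -> V -> Prop) : Prop :=
  forall v : V, ~ E v v.

Definition infinite_chromatic (V : Type) (E : V -> V -> Prop) : Prop :=
  forall (k : nat) (col : V -> 'I_k),
    exists x y : V, E x y /\ col x = col y.

(* n counts the vertices of the path, and v lists them in order. *)
Definition directed_path (V : Type) (E : V -> V -> Prop) (n : nat)
    (v : 'I_n -> V) : Prop :=
  injective v /\ forall i j : 'I_n, j = i.+1 :> nat -> E (v i) (v j).

Definition monochromatic (V : Type) (k : nat) (col : V -> 'I_k) (n : nat)
    (v : 'I_n -> V) : Prop :=
  exists c : 'I_k, forall i : 'I_n, col (v i) = c.

Definition accessible (V : Type) (E : V -> V -> Prop) : Prop :=
  forall (k : nat) (col : V -> 'I_k) (n : nat), 0 < n ->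
    exists v : 'I_n -> V, directed_path E v /\ monochromatic col v.

(* Main.v *)
Require Import Defs.
From mathcomp Require Import all_boot.
From mathcomp Require Import boolp classical_sets.

Set Implicit Arguments.
Unset Strict Implicit.
Unset Printing Implicit Defensive.

(** A monochromatic path with two vertices is an edge whose ends share a color,
    so accessibility implies infinite chromatic number.

    For the converse, suppose that a coloring with [k] colors has no
    monochromatic path on [n] vertices. The edges inside the color classes form
    a loopless graph [F] without paths on [n] vertices, and the Gallai-Roy
    argument colors [F] properly with [n] colors ([gallai_roy]). Pairing the two
    colorings gives a proper coloring of the whole graph with [k * n] colors.

    To color [F], take a maximal acyclic set [A] of edges of [F]. It exists by
    Zorn's lemma because a cycle is finite, so that a cycle in the union of a
    chain already lies in a member of the chain. Walks in [A] repeat no vertex,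
    hence have fewer than [n] vertices, and the length [l v] of the longest walk
    in [A] ending at [v] is a well-defined number below [n]. An edge [(x, y)]
    of [A] gives [l x < l y]. If an edge [(x, y)] of [F] is not in [A], adding
    it to [A] creates a cycle by maximality, so [A] contains a walk from [y] to
    [x], and [l y < l x]. In both cases the ends get different colors. *)

Section Walks.
Variable V : Type.
Implicit Types (A B : set (V * V)) (x y z : V).

(** Walks are built by adding edges at the end; the vertices in between are
    only named when needed, by [walk_vertices]. *)
Fixpoint walk A (m : nat) x y : Prop :=
  if m is m'.+1 then exists2 z, walk A m' x z & A (z, y) else x = y.

Definition acyclic A := forall m x, ~ walk A m.+1 x x.

Lemma walk_sub A B m x y : (A `<=` B)%classic -> walk A m x y -> walk B m x y.
Proof.
move=> AB; elim: m y => [//|m IH] y /= [z xz zy].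
by exists z; [exact: IH | exact: AB].
Qed.

Lemma walk_cat A m1 m2 x y z :
  walk A m1 x y -> walk A m2 y z -> walk A (m1 + m2) x z.
Proof.
move=> xy; elim: m2 z => [|m2 IH] z; first by rewrite addn0 => <-.
by rewrite addnS => -[t yt tz]; exists t => //; exact: IH.
Qed.

Lemma walk_vertices A m x y : walk A m x y ->
  exists w : nat -> V, w m = y /\ forall i, i < m -> A (w i, w i.+1).
Proof.
elim: m y => [|m IH] y; first by exists (fun=> y).
move=> [z /IH[w [wm Aw]] zy].
exists (fun i => if i <= m then w i else y); split; first by rewrite ltnn.
move=> i; rewrite ltnS => im; rewrite im.
by case: ltngtP im => // [/Aw //|-> _]; rewrite wm.
Qed.

Lemma walk_between A m (w : nat -> V) :
  (forall i, i < m -> A (w i, w i.+1)) ->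
  forall i d, i + d <= m -> walk A d (w i) (w (i + d)).
Proof.
move=> Aw i; elim=> [|d IH]; first by rewrite addn0.
rewrite addnS => idm; exists (w (i + d)); last exact: Aw.
exact/IH/ltnW.
Qed.

(** A repeated vertex on a walk would close a cycle. *)
Lemma acyclic_walk_path A (F : V -> V -> Prop) m n x y :
  (forall p, A p -> F p.1 p.2) -> acyclic A ->
  walk A m x y -> n <= m.+1 -> exists v : 'I_n -> V, directed_path F v.
Proof.
move=> AF acA /walk_vertices[w [_ Aw]] nm.
exists (fun i : 'I_n => w i); split; last first.
  move=> i j ji; rewrite ji; apply: (AF (w i, w i.+1)); apply: Aw.
  by rewrite -ji -ltnS (leq_trans (ltn_ord j)).
have ww i j : i < j -> j < n -> w i <> w j.
  move=> ij jn wij; have jm : i + (j - i) <= m.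
    by rewrite subnKC ?(ltnW ij)// -ltnS (leq_trans jn).
  have := walk_between Aw jm; rewrite (subnKC (ltnW ij)) -wij.
  by rewrite -[j - i]prednK ?subn_gt0//; exact: acA.
move=> i j wij; apply: val_inj => /=.
case: (ltngtP i j) => // [ij|ji].
- by case: (ww _ _ ij (ltn_ord j)).
- by case: (ww _ _ ji (ltn_ord i)).
Qed.

(** Only finitely many members of the chain supply the edges of a walk, and
    the largest of them contains all these edges. *)
Lemma walk_bigcup_chain (C : set (set (V * V))) m x y :
  total_on C subset -> walk (\bigcup_(A in C) A)%classic m.+1 x y ->
  exists2 A, C A & walk A m.+1 x y.
Proof.
move=> totC; elim: m y => [|m IH] y [z].
  by move=> xz [A CA Azy]; exists A => //; exists z.
move=> /IH[A CA xz] [B CB Bzy].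
have [AB|BA] := totC _ _ CA CB.
- by exists B => //; exists z => //; exact: walk_sub xz.
- by exists A => //; exists z => //; exact: BA.
Qed.

Lemma exists_maximal_acyclic (S : set (V * V)) :
  exists A, [/\ (A `<=` S)%classic, acyclic A &
    forall p, S p -> ~ A p -> ~ acyclic (A `|` [set p])%classic].
Proof.
pose P : set (set (V * V)) := fun A => (A `<=` S)%classic /\ acyclic A.
have [C CP totC|A [[AS acA] maxA]] := @Zorn_bigcup _ P.
  split; first by move=> p [A CA Ap]; have [AS _] := CP _ CA; exact: AS.
  by move=> m x /(walk_bigcup_chain totC)[A CA]; have [_ acA] := CP _ CA; exact: acA.
exists A; split=> // p Sp nAp acAp.
apply: (maxA (A `|` [set p])%classic).
  split; first by move=> q; left.
  by move=> ApA; apply/nAp/ApA; right.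
by split=> // q [Aq|->]; first exact: AS.
Qed.

(** In the second case, cut the walk before the first and after the last use
    of the edge [(x, y)]. *)
Lemma walk_add_edge A x y m a b : walk (A `|` [set (x, y)])%classic m a b ->
  walk A m a b \/ (exists i, walk A i a x) /\ (exists j, walk A j y b).
Proof.
elim: m b => [|m IH] b; first by left.
move=> [z /IH[az|[ax [j yz]]]] [zb|[zx byE]].
- by left; exists z.
- by right; rewrite -zx byE; split; [exists m | exists 0].
- by right; split=> //; exists j.+1, z.
- by right; split=> //; rewrite byE; exists 0.
Qed.

Lemma add_edge_cycle A x y : acyclic A ->
  ~ acyclic (A `|` [set (x, y)])%classic -> exists m, walk A m y x.
Proof.
move=> acA nac; apply: contrapT => nyx; apply: nac => m a.
case/walk_add_edge=> [/acA //|[[i ax] [j ya]]].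
by apply: nyx; exists (j + i); exact: walk_cat ya ax.
Qed.

(** Take for [l v] the length of the longest walk ending at [v]: a longest walk
    to [x] followed by a walk from [x] to [y] is a walk to [y]. *)
Lemma bounded_walks_level A n :
  (forall m x y, walk A m x y -> m < n) ->
  exists l : V -> 'I_n, forall m x y, walk A m x y -> l x + m <= l y.
Proof.
move=> bnd.
pose P v m := exists u, walk A m u v.
have lP v : exists l : 'I_n, P v l /\ forall m, P v m -> m <= l.
  have exP : exists m, `[< P v m >] by exists 0; apply/asboolP; exists v.
  have ubP m : `[< P v m >] -> m <= n by move=> /asboolP[u /bnd/ltnW].
  case: (ex_maxnP exP ubP) => l /asboolP[u uv] maxl.
  exists (Ordinal (bnd _ _ _ uv)); split; first by exists u.
  by move=> m /asboolP; exact: maxl.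
have [l Hl] := choice lP.
exists l => m x y xy; apply: (Hl y).2.
by have [[u ux] _] := Hl x; exists u; exact: walk_cat ux xy.
Qed.

End Walks.

(** The Gallai-Roy theorem for possibly infinite graphs: along each edge the
    level in a maximal acyclic subgraph either increases or decreases. *)
Lemma gallai_roy (V : Type) (F : V -> V -> Prop) (n : nat) :
  loopless F -> ~ (exists v : 'I_n -> V, directed_path F v) ->
  exists c : V -> 'I_n, forall x y, F x y -> c x <> c y.
Proof.
move=> hF noP.
have [A [AF acA maxA]] := exists_maximal_acyclic (fun p => F p.1 p.2).
have bnd m x y : walk A m x y -> m < n.
  move=> xy; rewrite ltnNge; apply/negP => nm; apply: noP.
  exact: acyclic_walk_path AF acA xy (leqW nm).
have [l lP] := bounded_walks_level bnd.
exists l => x y Fxy lxy.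
have [Axy|nAxy] := pselect (A (x, y)).
  have /lP : walk A 1 x y by exists x.
  by rewrite lxy addn1 ltnn.
have [[|m] yx] := add_edge_cycle acA (maxA (x, y) Fxy nAxy).
  (* A walk without edges from y to x means that (x, y) is a loop. *)
  by apply: (hF x); rewrite -{2}yx.
by have := lP _ _ _ yx; rewrite lxy addnS ltnNge leq_addr.
Qed.

Lemma directed_path_sub (V : Type) (E F : V -> V -> Prop) n (v : 'I_n -> V) :
  (forall x y, F x y -> E x y) -> directed_path F v -> directed_path E v.
Proof. by move=> FE [injv Fv]; split=> // i j /Fv/FE. Qed.

Lemma path_monochromatic (V : Type) (F : V -> V -> Prop) k (col : V -> 'I_k)
    n (v : 'I_n -> V) :
  0 < n -> (forall x y, F x y -> col x = col y) -> directed_path F v ->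
  monochromatic col v.
Proof.
case: n v => // n v _ Fcol [_ Fv]; exists (col (v ord0)) => -[i].
elim: i => [|i IH] lti; first by congr (col (v _)); exact: val_inj.
by rewrite -(IH (ltnW lti)); apply/esym/Fcol/Fv.
Qed.

Theorem theorem3p5 (V : Type) (E : V -> V -> Prop) (hE : loopless E) :
  infinite_chromatic E <-> accessible E.
Proof.
split=> [infE k col n n_gt0|accE k col]; last first.
  have [v [[_ Ev] [c vc]]] := accE k col 2 isT.
  by exists (v ord0), (v ord_max); rewrite !vc; split=> //; exact: Ev.
pose F x y := E x y /\ col x = col y.
have [[v Fv]|noP] := pselect (exists v : 'I_n -> V, directed_path F v).
  exists v; split; first by apply: directed_path_sub Fv => x y [].
  by apply: path_monochromatic Fv => // x y [].
have hF : loopless F by move=> x [/hE].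
have [c cP] := gallai_roy hF noP.
have [x [y [Exy /enum_rank_inj[colxy cxy]]]] :=
  infE _ (fun v => enum_rank (col v, c v)).
by case: (cP x y).
Qed.
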